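(* Let $\delta\in\mathbb{R}$, $a\in\mathbb{R}$, $b\ge0$ and $\theta\in(0,\infty]$. Then $\psi^{(a,b)}\in\ell^\theta(\mathbb{Z}^3)$ if and only if the following holds. If $\delta\ge0$: $b\theta>2$ and $b(1-2\delta)<a<-\frac{3\delta}{\theta}+b$ in the case $\theta\in(0,\infty)$; $b(1-2\delta)\le a\le b$ in the case $\theta=\infty$. If $\delta<0$: $b\theta>2$ and $-\frac{3\delta}{\theta}+b<a<b(1-2\delta)$ in the case $\theta\in(0,\infty)$; $b\le a\le b(1-2\delta)$ in the case $\theta=\infty$.
   Context: For $\delta\in\mathbb{R}$ and $n,m_1,m_2\in\mathbb{Z}$ let $B^{\delta}_{n,m_1,m_2}=\begin{pmatrix}2^n&m_12^n&m_22^n\\0&2^{n(1-\delta)}&m_12^{n(1-\delta)}\\0&0&2^{n(1-2\delta)}\end{pmatrix}$ and $A^{\delta}_{n,m_1,m_2}:=\left(B^{\delta}_{-n,m_1,m_2}\right)^{-T}$. With the norm $\|h\|=\sum_{1\le i,j\le3}|h_{i,j}|$ on $3\times3$ matrices this gives $\|A^{\delta}_{n,m_1,m_2}\|=2^n+2^{n(1-\delta)}+2^{n(1-2\delta)}+\left(2^{n(1-\delta)}+2^{n(1-2\delta)}\right)|m_1|+2^{n(1-2\delta)}|m_1^2-m_2|$. For $a,b\in\mathbb{R}$ the sequence $\psi^{(a,b)}$ on $\mathbb{Z}^3$ is defined by $\psi^{(a,b)}_{n,m_1,m_2}=2^{na}\|A^{\delta}_{n,m_1,m_2}\|^{-b}$.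 *)

(* Defs.v *)
From mathcomp Require Import all_boot all_order all_algebra.
From mathcomp Require Import all_classical all_reals all_analysis.

Set Implicit Arguments.
Unset Strict Implicit.
Unset Printing Implicit Defensive.

Import Order.TTheory GRing.Theory Num.Theory.
Import numFieldNormedType.Exports.

Local Open Scope classical_set_scope.
Local Open Scope ring_scope.

(* All powers of 2 are real powers, since the exponents n(1-delta) and
   n(1-2delta) are real. *)
Definition Bmx (R : realType) (delta : R) (n m1 m2 : int) : 'M[R]_3 :=
  let x : R := n%:~R in
  let y : R := x * (1 - delta) in
  let z : R := x * (1 - 2 * delta) in
  \matrix_(i < 3, j < 3)
    nth 0 (nth [::] [:: [:: 2 `^ x; m1%:~R * 2 `^ x; m2%:~R * 2 `^ x];
                        [:: 0;      2 `^ y;          m1%:~R * 2 `^ y];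
                        [:: 0;      0;               2 `^ z         ]] i) j.

Definition Amx (R : realType) (delta : R) (n m1 m2 : int) : 'M[R]_3 :=
  (invmx (Bmx delta (- n) m1 m2))^T.

(* The library's norm on matrices is the maximum norm, not the entrywise sum. *)
Definition mxnorm1 (R : realType) (h : 'M[R]_3) : R :=
  \sum_(i < 3) \sum_(j < 3) `|h i j|.

Definition psi (R : realType) (delta a b : R) (k : int * int * int) : R :=
  let: (n, m1, m2) := k in
  2 `^ (n%:~R * a) * mxnorm1 (Amx delta n m1 m2) `^ (- b).

(* Only 0 < theta is meaningful: the value at -oo is a convention. *)
Definition in_ell (R : realType) (I : choiceType) (theta : \bar R)
    (f : I -> R) : Prop :=
  match theta with
  | t%:E => summable setT (fun k => (`|f k| `^ t)%:E)
  | +oo => bounded_fun (f : I -> R^o)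
  | -oo => False
  end%E.

(* Main.v *)
Require Import Defs.
From mathcomp Require Import all_boot all_order all_algebra.
From mathcomp Require Import all_classical all_reals all_analysis.
From mathcomp Require Import ring lra.

(** Write p, q, r for 2^n, 2^(n(1-delta)), 2^(n(1-2delta)) and k for
    m1^2 - m2.  The norm of A_(n,m1,m2) is
    p + q + r + (q + r)|m1| + r|k|, where p, q, r is a geometric progression.
    Its largest term M is p or r according to the sign of n * delta, and
    with mu = min(1, 2^(-n delta)) the norm lies between
    M (1 + mu|m1| + mu^2|k|) and three times that
    ([mxnorm1_Amx_bounds]).  For fixed n and m1 the map m2 |-> k is a
    bijection of the integers, so (n, m1, k) can replace (n, m1, m2).

    For finite theta = t, the t-th power of psi^(a,b) is psi^(at,bt), so only
    the convergence of the sum of psi^(a,s), s = bt, is at stake.  For fixed n,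
    the sum over (m1, k) of (1 + mu|m1| + mu^2|k|)^(-s) is a Riemann sum, of
    mesh mu in one direction and mu^2 in the other, of the function
    (1 + x + y)^(-s), integrable on the quadrant exactly when s > 2.
    - If s > 2 this sum is comparable to mu^(-3).  Upper bound: since
      (1 + x + y)^2 >= (1 + x)(1 + y), it is at most a product of two
      one-dimensional sums of (1 + lambda|m|)^(-s/2), each of order 1/lambda
      by telescoping ([esum_bracket_le], [psi_fiber_sum_le]).  Lower bound:
      the box mu|m1| <= 1, mu^2|k| <= 1 has at least mu^(-3) points
      ([psi_fiber_sum_ge]).
    - If s <= 2 the slice n = 0 alone dominates a harmonic series
      ([psi_fiber_sum0_pinfty]).

    What remains is the sum over n of 2^(na) M^(-s) mu^(-3).  On each of the
    half-lines n >= 0 and n < 0 this is an exponential 2^(n E); the two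
    exponents E are a - s + 3 delta (where n delta >= 0) and a - s (1 - 2 delta)
    (where n delta <= 0), so the sum converges exactly when both half-lines
    decay ([esum_psi_lty]).  The sign of delta decides which exponent goes with
    which half-line, hence the two cases of the criterion.

    For theta = oo the supremum over (m1, k) is attained up to a constant at
    m1 = k = 0, and what must be bounded in n is 2^(na) M^(-b): the same
    two-sided exponential without the factor mu^(-3) ([psi_bounded]). *)

Set Implicit Arguments.
Unset Strict Implicit.

Import Order.TTheory GRing.Theory Num.Theory.
Import numFieldNormedType.Exports.

Local Open Scope classical_set_scope.
Local Open Scope ring_scope.

(** * Unordered sums over the integers *)

Lemma le_sum_esum (R : realType) (T : choiceType) (f : T -> \bar R)
    (e : nat -> T) (n : nat) :
  injective e -> (forall i, 0 <= f i)%E ->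
  (\sum_(i < n) f (e i) <= \esum_(i in [set: T]) f i)%E.
Proof.
move=> einj f0; apply: esum_ge; exists (e @` `I_n).
  by split=> //; exact/finite_image/finite_II.
rewrite fsbig_image; last by move=> i j _ _ /einj.
by rewrite (fsbig_ord _ n (fun i => f (e i))).
Qed.

(** The form in which divergence is used: it suffices to exhibit infinitely
    many terms bounded below. *)
Lemma esum_infinitely_ge (R : realType) (T : choiceType) (f : T -> \bar R)
    (e : nat -> T) (c : R) :
  injective e -> (forall i, 0 <= f i)%E -> 0 < c ->
  (forall i, c%:E <= f (e i))%E -> ~ (\esum_(i in [set: T]) f i < +oo)%E.
Proof.
move=> einj f0 c0 fc.
have lb n : ((c * n%:R)%:E <= \esum_(i in [set: T]) f i)%E.
  apply: le_trans (le_sum_esum n einj f0).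
  have -> : c * n%:R = \sum_(i < n) c by rewrite sumr_const card_ord mulr_natr.
  by rewrite -sumEFin; apply: lee_sum => i _.
case: (esum _ _) lb => [S|//|] lb => [_|_]; last first.
  by have := lb 0%N; rewrite mulr0 leeNy_eq.
have := truncnS_gt (S / c); rewrite ltr_pdivrMr// mulrC ltNge.
by rewrite -lee_fin lb.
Qed.

(** Partial sums of [h] control both halves of the sum over the integers: the
    negative one is the same series without its term at 0. *)
Lemma esum_int_le (R : realType) (h : nat -> R) (B : R) :
  (forall i, 0 <= h i) -> (forall n, \sum_(i < n) h i <= B) ->
  (\esum_(m in [set: int]) (h `|m|%N)%:E <= (2 * B)%:E)%E.
Proof.
move=> h0 hB.
have half (e : nat -> int) (g : nat -> nat) : injective e ->
    (forall i, `|e i|%N = g i) -> (forall n, \sum_(i < n) h (g i) <= B) ->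
    (\esum_(m in range e) (h `|m|%N)%:E <= B%:E)%E.
  move=> einj eg gB; rewrite esum_image; last by move=> i j _ _ /einj.
  under eq_esum do rewrite eg.
  rewrite -nneseries_esumT; last by move=> i; rewrite lee_fin.
  apply: lime_le; first by apply: is_cvg_nneseries => i _ _; rewrite lee_fin.
  by near=> n; rewrite sumEFin lee_fin big_mkord.
have NegE : [set: int] `&` ~` range Posz = range Negz.
  apply/seteqP; split=> [[i|i]|_ [i _ <-]] /=; last by split=> // -[].
    by case=> _ []; exists i.
  by exists i.
rewrite (esumID (range Posz)); last by move=> i _; rewrite lee_fin.
rewrite mulr2n mulrDl mul1r EFinD setTI NegE; apply: leeD.
  by apply: (half _ id) => // i j [].
apply: (half _ succn) => [i j []//|//|n].
apply: le_trans (hB n.+1); rewrite big_ord_recl lerDr.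
exact: h0.
Unshelve. all: by end_near. Qed.

(** The naturals up to the integer part of 1 / lambda, 0 included, number more
    than 1 / lambda and satisfy lambda * m <= 1. *)
Lemma esum_int_ge (R : realType) (f : int -> \bar R) (c lambda : R) :
  (forall m, 0 <= f m)%E -> 0 <= c -> 0 < lambda ->
  (forall m : int, lambda * `|m%:~R| <= 1 -> (c%:E <= f m)%E) ->
  ((c / lambda)%:E <= \esum_(m in [set: int]) f m)%E.
Proof.
move=> f0 c0 l0 fc; set K := Num.truncn lambda^-1.
have Kl : K%:R <= lambda^-1 by rewrite truncn_le invr_ge0 ltW.
apply: le_trans (@le_sum_esum _ _ f Posz K.+1 _ f0); last by move=> i j [].
apply: (@le_trans _ _ (\sum_(i < K.+1) c%:E)%E).
  rewrite sumEFin sumr_const card_ord lee_fin -mulr_natr ler_wpM2l//.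
  by rewrite ltW// truncnS_gt.
apply: lee_sum => i _; apply: fc; rewrite -pmulrn normr_nat.
rewrite mulrC -ler_pdivlMr// div1r.
by apply: le_trans Kl; rewrite ler_nat -ltnS ltn_ord.
Qed.

(** For fixed n and m1, m |-> g m1 - m permutes the integers; with
    g m1 = m1 ^ 2 this makes m the corner entry m1 ^ 2 - m2 of the norm. *)
Lemma esum_shear (R : realType) (f : int * int * int -> \bar R)
    (g : int -> int) : (forall k, 0 <= f k)%E ->
  \esum_(k in [set: int * int * int]) f k =
  \esum_(n in [set: int]) \esum_(m1 in [set: int]) \esum_(m in [set: int])
    f (n, m1, g m1 - m).
Proof.
move=> f0.
transitivity (\esum_(n in [set: int]) \esum_(m1 in [set: int])
    \esum_(m2 in [set: int]) f (n, m1, m2)); last first.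
  apply: eq_esum => n _; apply: eq_esum => m1 _; apply: reindex_esum.
  split=> // [m m' _ _ /addrI/oppr_inj//|m _].
  by exists (g m1 - m) => //; rewrite subKr.
rewrite [RHS](@esum_esum _ _ _ _ (fun=> [set: int])); last first.
  by move=> *; exact: esum_ge0.
rewrite [RHS](@esum_esum _ _ _ _ (fun=> [set: int])
  (fun k m2 => f (k.1, k.2, m2)))//.
rewrite /= (_ : _ `*`` _ = [set: int * int * int]); last first.
  by apply/seteqP; split.
by apply: eq_esum => -[[n m1] m2].
Qed.

Lemma esum_harmonic (R : realType) (f : int -> \bar R) (c : R) :
  (forall m, 0 <= f m)%E -> 0 < c ->
  (forall i : nat, (c / i.+1%:R)%:E <= f i)%E ->
  ~ (\esum_(m in [set: int]) f m < +oo)%E.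
Proof.
move=> f0 c0 fc ltS; apply: (@dvg_harmonic R).
apply: nondecreasing_is_cvgn.
  by apply/nondecreasing_series => i _ _; rewrite invr_ge0.
exists (fine (\esum_(m in [set: int]) f m) / c) => _ [n _ <-].
rewrite ler_pdivlMr// -lee_fin fineK; last first.
  by rewrite ge0_fin_numE// esum_ge0.
apply: le_trans (@le_sum_esum _ _ f Posz n _ f0); last by move=> i j [].
rewrite /series/= big_mkord mulr_suml -sumEFin.
by apply: lee_sum => i _; rewrite mulrC.
Qed.

(** * Sums of negative powers of 1 + lambda |m| *)

Lemma powRN_anti (R : realType) (x y s : R) :
  0 < x -> x <= y -> 0 <= s -> y `^ (- s) <= x `^ (- s).
Proof.
move=> x0 xy s0; have y0 := lt_le_trans x0 xy.
by rewrite !powRN lef_pV2 ?posrE ?powR_gt0// ge0_ler_powR ?nnegrE// ltW.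
Qed.

(** A derivative-free form of the mean value inequality for y ^ (1 - sigma).
    Dividing by y ^ (1 - sigma), it reads
    1 + (sigma - 1) u <= (1 - u) ^ (1 - sigma) with u = lambda / y, which
    follows from ln (1 - u) <= - u and 1 + x <= exp x. *)
Lemma powRN_telescope (R : realType) (y lambda sigma : R) :
  1 < sigma -> 0 < lambda < y ->
  (sigma - 1) * lambda * y `^ (- sigma) <=
  (y - lambda) `^ (1 - sigma) - y `^ (1 - sigma).
Proof.
move=> s1 /andP[l0 ly]; have y0 := lt_trans l0 ly.
set u := lambda / y.
have /andP[u0 u1] : 0 < u < 1 by rewrite divr_gt0// ltr_pdivrMr// mul1r.
have yN0 : y != 0 by rewrite gt_eqF.
have -> : y `^ (- sigma) = y `^ (1 - sigma) / y.
  have {1}-> : - sigma = (1 - sigma) + - 1 by ring.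
  by rewrite powRD ?yN0 ?implybT// powR_inv1// ltW.
have -> : y - lambda = y * (1 - u) by rewrite /u; field.
rewrite powRM; [|lra|lra].
suff H : 1 + (sigma - 1) * u <= (1 - u) `^ (1 - sigma).
  rewrite (_ : _ * (_ / y) = y `^ (1 - sigma) * ((sigma - 1) * u)); last first.
    by rewrite /u; field.
  have := ler_wpM2l (ltW (powR_gt0 (1 - sigma) y0)) H; lra.
have lnu : ln (1 - u) <= - u by apply: le_ln1Dx; lra.
rewrite /powR gt_eqF; last lra.
apply: le_trans (expR_ge1Dx _); nra.
Qed.

(** The bound is uniform in [lambda]: this is the integral of
    (1 + lambda x) ^ (- sigma) over the half-line, plus the term at 0, which is
    at most 1 / lambda since lambda <= 1. *)
Lemma sum_bracket_le (R : realType) (lambda sigma : R) (n : nat) :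
  1 < sigma -> 0 < lambda <= 1 ->
  \sum_(i < n) (1 + lambda * i%:R) `^ (- sigma) <=
  (sigma / (sigma - 1)) / lambda.
Proof.
move=> s1 /andP[l0 l1]; rewrite ler_pdivlMr// ler_pdivlMr; last lra.
case: n => [|n]; first by rewrite big_ord0; lra.
(* Keeping the remainder of the telescoping sum makes the induction work. *)
suff : (\sum_(i < n.+1) (1 + lambda * i%:R) `^ (- sigma)) * lambda *
  (sigma - 1) <= sigma - (1 + lambda * n%:R) `^ (1 - sigma).
  by move/le_trans; apply; rewrite gerBl powR_ge0.
elim: n => [|n IH].
  by rewrite big_ord1 mulr0 addr0 !powR1; nra.
rewrite big_ord_recr /=.
have n0 : 0 <= lambda * n%:R by rewrite mulr_ge0// ltW.
have := @powRN_telescope R (1 + lambda * n.+1%:R) lambda _ s1.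
rewrite (_ : 1 + lambda * n.+1%:R - lambda = 1 + lambda * n%:R); last first.
  by rewrite -natr1; ring.
rewrite l0 -natr1 mulrDr mulr1 addrA ltrDr ltr_wpDr// => /(_ isT); lra.
Qed.

Lemma esum_bracket_le (R : realType) (c lambda sigma : R) :
  0 <= c -> 1 < sigma -> 0 < lambda <= 1 ->
  (\esum_(m in [set: int]) (c * (1 + lambda * `|m%:~R|) `^ (- sigma))%:E <=
   (c * (2 * (sigma / (sigma - 1))) / lambda)%:E)%E.
Proof.
move=> c0 s1 l01.
under eq_esum do rewrite -intr_norm -natr_absz.
rewrite (_ : c * _ / _ = 2 * (c * ((sigma / (sigma - 1)) / lambda))); last ring.
apply: (@esum_int_le _ (fun i => c * (1 + lambda * i%:R) `^ (- sigma)))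
  => [i|n].
  by rewrite mulr_ge0 ?powR_ge0.
by rewrite -mulr_sumr ler_wpM2l// sum_bracket_le.
Qed.

(** * Two-sided exponentials *)

Definition two_sided (R : realType) (u v : R) (n : int) : R :=
  2 `^ (`|n|%N%:R * (if 0 <= n then u else v)).

Lemma esum_two_sided_lty (R : realType) (c u v : R) : 0 <= c ->
  u < 0 -> v < 0 ->
  (\esum_(n in [set: int]) (c * two_sided u v n)%:E < +oo)%E.
Proof.
move=> c0 u0 v0.
(* Both half-lines are dominated by the slower of the two geometric series. *)
set w := Num.max u v.
have w0 : w < 0 by rewrite gt_max u0 v0.
set x := 2 `^ w.
have x1 : x < 1.
  by rewrite -(powRr0 2) /x /powR gt_eqF// ltr_expR ltr_pM2r// ln_gt0// ltr1n.
have x0 : 0 <= x := powR_ge0 _ _.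
suff : (\esum_(n in [set: int]) (c * x ^+ `|n|%N)%:E <=
        (2 * (c / (1 - x)))%:E)%E.
  move=> H; apply: le_lt_trans (ltry _); apply: le_trans H.
  apply: le_esum => n _; rewrite lee_fin ler_wpM2l//.
  rewrite -powR_mulrn// -powRrM mulrC ler_powR ?ler1n//.
  by rewrite ler_wpM2l//; case: ifP => _; rewrite le_max lexx ?orbT.
apply: (@esum_int_le _ (fun i => c * x ^+ i)) => [i|n].
  by rewrite mulr_ge0// exprn_ge0.
rewrite -mulr_sumr ler_wpM2l// -[leRHS]mul1r ler_pdivlMr ?subr_gt0//.
have := subrX1 x n; have := exprn_ge0 n x0; lra.
Qed.

Lemma two_sided_ge1 (R : realType) (u v : R) : ~ (u < 0 /\ v < 0) ->
  exists2 e : nat -> int, injective e & forall i, 1 <= two_sided u v (e i).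
Proof.
move=> /not_andP uv.
have [u0|u0] := leP 0 u.
  exists Posz => [i j []//|i].
  by rewrite -(powRr0 2) ler_powR ?ler1n// mulr_ge0.
have v0 : 0 <= v by case: uv => /negP; rewrite -leNgt //; lra.
exists Negz => [i j []//|i].
by rewrite -(powRr0 2) ler_powR ?ler1n// mulr_ge0.
Qed.

Lemma powR2_unbounded (R : realType) (w B : R) : 0 < w ->
  ~ (forall i : nat, 2 `^ (i.+1%:R * w) <= B).
Proof.
move=> w0 wB; have l0 : 0 < ln 2 :> R by rewrite ln_gt0// ltr1n.
have wl0 : 0 < w * ln 2 by rewrite mulr_gt0.
set K := Num.truncn (B / (w * ln 2)).
have : B < K.+1%:R * (w * ln 2) by rewrite -ltr_pdivrMr// truncnS_gt.
have := wB K; rewrite /powR gt_eqF//.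
have := expR_ge1Dx (K.+1%:R * w * ln 2); rewrite -mulrA; lra.
Qed.

Lemma two_sided_bounded (R : realType) (u v : R) :
  (exists B, forall n, two_sided u v n <= B) <-> u <= 0 /\ v <= 0.
Proof.
split=> [[B uvB]|[u0 v0]].
  split; rewrite leNgt; apply/negP => w0; apply: (powR2_unbounded w0) => i.
    exact: (uvB i.+1).
  exact: (uvB (Negz i)).
exists 1 => n; rewrite -(powRr0 2) ler_powR ?ler1n//.
by rewrite mulr_ge0_le0//; case: ifP.
Qed.

(** * The size of the matrices A *)

(** With n negated, the matrix B is diag(p, q, r)^(-1) times a unipotent matrix,
    so its inverse is explicit and is verified by multiplying out. *)
Lemma Amx_entries (R : realType) (delta : R) (n m1 m2 : int) :
  let x : R := n%:~R in
  let p := 2 `^ x in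
  let q := 2 `^ (x * (1 - delta)) in
  let r := 2 `^ (x * (1 - 2 * delta)) in
  Amx delta n m1 m2 = \matrix_(i < 3, j < 3)
    nth 0 (nth [::] [:: [:: p;                   0;           0];
                        [:: - m1%:~R * q;        q;           0];
                        [:: (m1 ^+ 2 - m2)%:~R * r; - m1%:~R * r; r]] i) j.
Proof.
move=> x p q r.
have pN y : 2 `^ (- y) = (2 `^ y)^-1 :> R by rewrite powRN.
have p0 : p != 0 by rewrite gt_eqF ?powR_gt0.
have q0 : q != 0 by rewrite gt_eqF ?powR_gt0.
have r0 : r != 0 by rewrite gt_eqF ?powR_gt0.
set A := \matrix_(i, j) _.
suff BA : Bmx delta (- n) m1 m2 *m A^T = 1%:M.
  have [Bu _] := mulmx1_unit BA.
  by rewrite /Amx -[invmx _]mulmx1 -BA mulmxA mulVmx// mul1mx trmxK.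
apply/matrixP => i j; rewrite !mxE !big_ord_recr big_ord0 /= !mxE /=.
rewrite rmorphN /= !mulNr !pN -/x -/p -/q -/r.
rewrite rmorphB /= rmorphXn /=.
case: i => [[|[|[|i]]] hi] //; case: j => [[|[|[|j]]] hj] //=;
  rewrite /= ?(mulr0,mul0r,addr0,add0r) //; by field; rewrite ?p0 ?q0 ?r0.
Qed.

Lemma mxnorm1_Amx (R : realType) (delta : R) (n m1 m2 : int) :
  let x : R := n%:~R in
  let p := 2 `^ x in
  let q := 2 `^ (x * (1 - delta)) in
  let r := 2 `^ (x * (1 - 2 * delta)) in
  mxnorm1 (Amx delta n m1 m2) =
  p + q + r + (q + r) * `|m1%:~R| + r * `|(m1 ^+ 2 - m2)%:~R|.
Proof.
move=> x p q r; rewrite Amx_entries /mxnorm1 -/x -/p -/q -/r.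
rewrite !big_ord_recr !big_ord0 /= !mxE /= !normrM !normrN normr0.
rewrite !(ger0_norm (powR_ge0 _ _)). rewrite -/p -/q -/r; ring.
Qed.

(** The larger of 2 ^ n and 2 ^ (n (1 - 2 delta)), written so that its
    exponent is visible. *)
Definition psi_scale (R : realType) (delta : R) (n : int) : R :=
  2 `^ (n%:~R + Num.max 0 (- (2 * n%:~R * delta))).

(** The ratio, at most 1, by which the weights of |m1| and then of
    |m1 ^ 2 - m2| shrink relative to the scale. *)
Definition psi_aspect (R : realType) (delta : R) (n : int) : R :=
  2 `^ (- Num.max 0 (n%:~R * delta)).

Lemma psi_scale_gt0 (R : realType) (delta : R) n : 0 < psi_scale delta n.
Proof. exact: powR_gt0. Qed.

Lemma psi_aspect_gt0 (R : realType) (delta : R) n : 0 < psi_aspect delta n.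
Proof. exact: powR_gt0. Qed.

Lemma powR2_le1 (R : realType) (x : R) : x <= 0 -> 2 `^ x <= 1.
Proof. by move=> x0; rewrite -[leRHS](powRr0 2) ler_powR// ler1n. Qed.

Lemma psi_aspect_le1 (R : realType) (delta : R) n : psi_aspect delta n <= 1.
Proof. by apply: powR2_le1; rewrite oppr_le0 le_max lexx. Qed.

Lemma powR2D (R : realType) (x y : R) : 2 `^ (x + y) = 2 `^ x * 2 `^ y.
Proof. by rewrite powRD// pnatr_eq0 implybT. Qed.

Definition psi_bracket (R : realType) (delta : R) (n m1 m : int) : R :=
  1 + psi_aspect delta n * `|m1%:~R| + psi_aspect delta n ^+ 2 * `|m%:~R|.

Lemma psi_bracket_ge1 (R : realType) (delta : R) n m1 m :
  1 <= psi_bracket delta n m1 m.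
Proof.
rewrite /psi_bracket -addrA lerDl addr_ge0// mulr_ge0// ?exprn_ge0//.
  exact/ltW/psi_aspect_gt0.
exact/ltW/psi_aspect_gt0.
Qed.

(** The powers p, q, r form a geometric progression of ratio 2 ^ (- n delta),
    decreasing from p when n delta >= 0 and increasing to r otherwise; the
    largest of them carries the scale, and the others are at most equal to
    it. *)
Lemma mxnorm1_Amx_bounds (R : realType) (delta : R) (n m1 m : int) :
  let B := psi_scale delta n * psi_bracket delta n m1 m in
  B <= mxnorm1 (Amx delta n m1 (m1 ^+ 2 - m)) <= 3 * B.
Proof.
rewrite mxnorm1_Amx subKr /psi_bracket /=.
have := psi_aspect_le1 delta n; have := psi_aspect_gt0 delta n.
have := psi_scale_gt0 delta n.
set x : R := n%:~R; set y1 := `|_|; set y2 := `|_|.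
have y10 : 0 <= y1 by exact: normr_ge0.
have y20 : 0 <= y2 by exact: normr_ge0.
have [d0|d0] := leP 0 (x * delta).
  have Mp : psi_scale delta n = 2 `^ x.
    by rewrite /psi_scale max_l ?addr0//; lra.
  have mu : psi_aspect delta n = 2 `^ (- (x * delta)).
    by rewrite /psi_aspect max_r.
  have -> : 2 `^ (x * (1 - delta)) = psi_scale delta n * psi_aspect delta n.
    by rewrite Mp mu -powR2D; congr (_ `^ _); ring.
  have -> : 2 `^ (x * (1 - 2 * delta)) =
            psi_scale delta n * psi_aspect delta n ^+ 2.
    by rewrite Mp mu expr2 -!powR2D; congr (_ `^ _); ring.
  rewrite -Mp.
  move: (psi_scale _ _) (psi_aspect _ _) => M nu M0 nu0 nu1.
  have nu2 : 0 <= nu ^+ 2 <= nu by rewrite expr2; nra.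
  have -> : M + M * nu + M * nu ^+ 2 + (M * nu + M * nu ^+ 2) * y1 +
      M * nu ^+ 2 * y2 =
      M * (1 + nu + nu ^+ 2 + (nu + nu ^+ 2) * y1 + nu ^+ 2 * y2) by ring.
  rewrite mulrCA !ler_pM2l//; move: (nu ^+ 2) nu2 => nn /andP[nn0 nn1].
  have h1 := ler_wpM2r y10 nn1. have h2 := mulr_ge0 nn0 y20.
  have h3 := mulr_ge0 nn0 y10. have h4 := mulr_ge0 (ltW nu0) y10.
  by apply/andP; split; lra.
have Mr : psi_scale delta n = 2 `^ (x * (1 - 2 * delta)).
  by rewrite /psi_scale max_r; [congr (_ `^ _); rewrite -/x; ring|lra].
have mu : psi_aspect delta n = 1.
  by rewrite /psi_aspect max_l ?oppr0 ?powRr0// ltW.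
set nu : R := 2 `^ (x * delta).
have -> : 2 `^ (x * (1 - delta)) = psi_scale delta n * nu.
  by rewrite Mr -powR2D; congr (_ `^ _); ring.
have -> : 2 `^ x = psi_scale delta n * nu ^+ 2.
  by rewrite Mr expr2 -!powR2D; congr (_ `^ _); ring.
rewrite -Mr mu expr1n !mul1r.
have nu0 : 0 <= nu := powR_ge0 _ _.
have nu1 : nu <= 1 by apply: powR2_le1; exact: ltW.
move: (psi_scale _ _) nu nu0 nu1 => M nu nu0 nu1 M0 _ _.
have nu2 : 0 <= nu ^+ 2 <= nu by rewrite expr2; nra.
have -> : M * nu ^+ 2 + M * nu + M + (M * nu + M) * y1 + M * y2
   = M * (nu ^+ 2 + nu + 1 + (nu + 1) * y1 + y2) by ring.
rewrite mulrCA !ler_pM2l//; move: (nu ^+ 2) nu2 => nn /andP[nn0 nn1].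
have h1 := ler_wpM2r y10 nu1. have h2 := mulr_ge0 nu0 y10.
by apply/andP; split; lra.
Qed.

Lemma mxnorm1_Amx_gt0 (R : realType) (delta : R) (n m1 m2 : int) :
  0 < mxnorm1 (Amx delta n m1 m2).
Proof.
have /andP[+ _] := mxnorm1_Amx_bounds delta n m1 (m1 ^+ 2 - m2).
rewrite subKr; apply: lt_le_trans.
by rewrite mulr_gt0 ?psi_scale_gt0// (lt_le_trans ltr01)// psi_bracket_ge1.
Qed.

(** * The sequence psi and its envelope in n *)

Lemma psi_ge0 (R : realType) (delta a b : R) k : 0 <= psi delta a b k.
Proof. by case: k => -[n m1] m2; rewrite mulr_ge0 ?powR_ge0. Qed.

(** Taking powers stays within the family, which reduces finite exponents to
    the convergence of a plain sum. *)
Lemma psi_powR (R : realType) (delta a b t : R) k :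
  `|psi delta a b k| `^ t = psi delta (a * t) (b * t) k.
Proof.
rewrite ger0_norm ?psi_ge0//; case: k => -[n m1] m2 /=.
by rewrite powRM ?powR_ge0// -!powRrM mulrA mulNr.
Qed.

Lemma psi_bounds (R : realType) (delta a s : R) (n m1 m : int) : 0 <= s ->
  let B := psi_scale delta n * psi_bracket delta n m1 m in
  2 `^ (n%:~R * a) * (3 * B) `^ (- s) <= psi delta a s (n, m1, m1 ^+ 2 - m)
  <= 2 `^ (n%:~R * a) * B `^ (- s).
Proof.
move=> s0; rewrite /psi; set B := psi_scale _ _ * _ => /=.
have /andP[BN NB] := mxnorm1_Amx_bounds delta n m1 m.
have B0 : 0 < B.
  by rewrite mulr_gt0 ?psi_scale_gt0// (lt_le_trans ltr01)// psi_bracket_ge1.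
rewrite !ler_pM2l ?powR_gt0//.
by apply/andP; split; apply: powRN_anti; rewrite ?mxnorm1_Amx_gt0.
Qed.

(** With [j = 3] this is the order of magnitude of the sum of psi over (m1, m2)
    at fixed n; with [j = 0], that of the supremum. *)
Definition psi_envelope (R : realType) (j : nat) (delta a s : R)
    (n : int) : R :=
  2 `^ (n%:~R * a) * psi_scale delta n `^ (- s) / psi_aspect delta n ^+ j.

(** The logarithm of the envelope is linear on each half-line of n, because
    the sign of n delta is constant there; the first exponent is the growth rate
    towards +oo, the second towards -oo. *)
Lemma psi_envelopeE (R : realType) (j : nat) (delta a s : R) n :
  psi_envelope j delta a s n = two_sided
   (if 0 <= delta then a - s + j%:R * delta else a - s * (1 - 2 * delta))
   (if 0 <= delta then s * (1 - 2 * delta) - a else s - a - j%:R * delta) n.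
Proof.
rewrite /psi_envelope /psi_aspect -powR_mulrn ?powR_ge0// -powRrM -powRN.
rewrite /psi_scale -powRrM -!powR2D /two_sided natr_absz intr_norm.
rewrite -(ler0z R); set x : R := n%:~R; congr (_ `^ _).
have [x0|x0] := leP 0 x; have [d0|d0] := leP 0 delta.
- by rewrite max_l ?max_r ?ger0_norm//; [ring|nra|nra].
- by rewrite max_r ?max_l ?ger0_norm//; [ring|nra|nra].
- by rewrite max_r ?max_l ?ltr0_norm//; [ring|nra|nra].
- by rewrite max_l ?max_r ?ltr0_norm//; [ring|nra|nra].
Qed.

(** * Sums over m1 and m2 for fixed n *)

Definition psi_fiber_sum (R : realType) (delta a s : R) (n : int) : \bar R :=
  \esum_(m1 in [set: int]) \esum_(m in [set: int])
    (psi delta a s (n, m1, m1 ^+ 2 - m))%:E.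

Lemma psi_fiber_sum_ge0 (R : realType) (delta a s : R) n :
  (0 <= psi_fiber_sum delta a s n)%E.
Proof.
by apply: esum_ge0 => m1 _; apply: esum_ge0 => m _; rewrite lee_fin psi_ge0.
Qed.

Lemma esum_psi (R : realType) (delta a s : R) :
  \esum_(k in [set: int * int * int]) (psi delta a s k)%:E =
  \esum_(n in [set: int]) psi_fiber_sum delta a s n.
Proof.
by rewrite (esum_shear (fun m1 => m1 ^+ 2))// => k; rewrite lee_fin psi_ge0.
Qed.

(** Since (1 + x + y) ^ 2 >= (1 + x) (1 + y), the summand is at most a product
    of powers with exponent s / 2 > 1, so the double sum is bounded by
    1 / mu ^ 2 (sum over m) times 1 / mu (sum over m1). *)
Lemma psi_fiber_sum_le (R : realType) (delta a s : R) n : 2 < s ->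
  let C := 2 * (s / 2 / (s / 2 - 1)) in
  (psi_fiber_sum delta a s n <= (C ^+ 2 * psi_envelope 3 delta a s n)%:E)%E.
Proof.
move=> s2; set C := 2 * _ => /=.
have s0 : 0 <= s by lra.
have sig1 : 1 < s / 2 by rewrite ltr_pdivlMr// mul1r.
have C0 : 0 <= C by rewrite /C mulr_ge0// divr_ge0; lra.
rewrite /psi_fiber_sum /psi_envelope.
set c := 2 `^ _ * _; set mu := psi_aspect delta n.
have c0 : 0 <= c by rewrite mulr_ge0 ?powR_ge0.
have mu0 : 0 < mu by exact: psi_aspect_gt0.
have mu1 : mu <= 1 by exact: psi_aspect_le1.
pose d m1 : R := c * (1 + mu * `|m1%:~R|) `^ (- (s / 2)).
have d0 m1 : 0 <= d m1 by rewrite mulr_ge0 ?powR_ge0.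
have psi_le m1 m : psi delta a s (n, m1, m1 ^+ 2 - m) <=
    d m1 * (1 + mu ^+ 2 * `|m%:~R|) `^ (- (s / 2)).
  have /andP[_] := psi_bounds delta a n m1 m s0.
  move=> /le_trans; apply.
  have b1 := psi_bracket_ge1 delta n m1 m.
  rewrite powRM ?(ltW (psi_scale_gt0 _ _))//; last lra.
  rewrite mulrA -/c /d -mulrA ler_wpM2l//.
  have x0 : 0 <= mu * `|m1%:~R| by rewrite mulr_ge0// ltW.
  have y0 : 0 <= mu ^+ 2 * `|m%:~R| by rewrite mulr_ge0// exprn_ge0// ltW.
  rewrite -powRM; [|lra|lra].
  (* The power - s is the power - (s / 2) of the square. *)
  rewrite {1}(_ : - s = 2 * - (s / 2)); last by field.
  rewrite powRrM (powR_mulrn 2); last lra.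
  move: x0 y0; rewrite /psi_bracket -/mu.
  move: (mu * _) (mu ^+ 2 * _) => x y x0 y0.
  by apply: powRN_anti; [rewrite mulr_gt0//; lra | nra | lra].
have mu2 : 0 < mu ^+ 2 <= 1 by rewrite exprn_gt0// expr_le1// ltW.
apply: (@le_trans _ _ (\esum_(m1 in [set: int])
    (c * C / mu ^+ 2 * (1 + mu * `|m1%:~R|) `^ (- (s / 2)))%:E)).
  apply: le_esum => m1 _.
  apply: le_trans (_ : _ <= (d m1 * C / mu ^+ 2)%:E)%E _.
    apply: le_trans (esum_bracket_le (d0 m1) sig1 mu2).
    by apply: le_esum => m _; rewrite lee_fin psi_le.
  by rewrite lee_fin /d le_eqVlt; apply/orP; left; apply/eqP; ring.
apply: le_trans (esum_bracket_le _ sig1 _) _.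
- by apply: divr_ge0; [exact: mulr_ge0 | case/andP: mu2 => /ltW].
- by rewrite mu0.
rewrite lee_fin -/C le_eqVlt; apply/orP; left; apply/eqP.
by field; rewrite gt_eqF.
Qed.

(** Only the box mu |m1| <= 1, mu ^ 2 |m| <= 1 is kept: there the bracket is at
    most 3, hence the norm at most 9 times the scale. *)
Lemma psi_fiber_sum_ge (R : realType) (delta a s : R) n : 0 <= s ->
  ((9 `^ (- s) * psi_envelope 3 delta a s n)%:E <= psi_fiber_sum delta a s n)%E.
Proof.
move=> s0; rewrite /psi_envelope.
set c := 2 `^ _ * _; set mu := psi_aspect delta n.
have c0 : 0 <= 9 `^ (- s) * c by rewrite !mulr_ge0 ?powR_ge0.
have mu0 : 0 < mu by exact: psi_aspect_gt0.
have psi_ge m1 m : mu * `|m1%:~R| <= 1 -> mu ^+ 2 * `|m%:~R| <= 1 ->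
    9 `^ (- s) * c <= psi delta a s (n, m1, m1 ^+ 2 - m).
  move=> x1 y1; have /andP[+ _] := psi_bounds delta a n m1 m s0.
  apply: le_trans; rewrite mulrCA ler_pM2l ?powR_gt0//.
  rewrite -powRM//; last exact/ltW/psi_scale_gt0.
  have M0 := psi_scale_gt0 delta n; have b1 := psi_bracket_ge1 delta n m1 m.
  apply: powRN_anti => //; first by rewrite !mulr_gt0// (lt_le_trans ltr01).
  have : psi_bracket delta n m1 m <= 3 by rewrite /psi_bracket -/mu; lra.
  by move=> /(ler_wpM2l (ltW M0)); lra.
have -> : 9 `^ (- s) * (c / mu ^+ 3) = 9 `^ (- s) * c / mu ^+ 2 / mu.
  by field; rewrite gt_eqF.
apply: esum_int_ge => //.
- by move=> m1; apply: esum_ge0 => m _; rewrite lee_fin psi_ge0.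
- by rewrite divr_ge0// exprn_ge0// ltW.
move=> m1 x1; apply: esum_int_ge => //.
- by move=> m; rewrite lee_fin psi_ge0.
- by rewrite exprn_gt0.
by move=> m y1; rewrite lee_fin psi_ge.
Qed.

(** For m1 = i >= 0, the terms with |m| <= i + 1 are each at least
    (6 (i + 1)) ^ (- 2), since s <= 2, and there are more than i + 1 of them; so
    the sum over m is at least 1 / (36 (i + 1)), a harmonic series in i. *)
Lemma psi_fiber_sum0_pinfty (R : realType) (delta a s : R) : 0 <= s <= 2 ->
  ~ (psi_fiber_sum delta a s 0 < +oo)%E.
Proof.
move=> /andP[s0 s2]; apply: (@esum_harmonic _ _ (36^-1)) => //.
  by move=> m1; apply: esum_ge0 => m _; rewrite lee_fin psi_ge0.
move=> i; have i0 : 0 < i.+1%:R :> R by [].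
(* Split as a lower bound for each term and, in the denominator, the mesh
   1 / (i + 1), which selects the m with |m| <= i + 1. *)
have -> : 36^-1 / i.+1%:R = (6 * i.+1%:R) ^- 2 / (i.+1%:R)^-1 :> R.
  by field; rewrite gt_eqF.
apply: esum_int_ge.
- by move=> m; rewrite lee_fin psi_ge0.
- by rewrite invr_ge0 exprn_ge0// mulr_ge0// ltW.
- by rewrite invr_gt0.
move=> m; rewrite mulrC ler_pdivrMr// mul1r => mi; rewrite lee_fin.
have /andP[+ _] := psi_bounds delta a 0 i m s0; apply: le_trans.
rewrite /psi_bracket /psi_scale /psi_aspect !(mul0r,mulr0,oppr0) maxxx.
rewrite !(addr0,oppr0,powRr0,expr1n,mul1r) -pmulrn normr_nat.
have i1 : 1 <= i.+1%:R :> R by rewrite ler1n.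
apply: (@le_trans _ _ ((6 * i.+1%:R) `^ (- s))).
  by rewrite -powR_invn ?mulr_ge0// ler_powR ?lerN2//; lra.
apply: powRN_anti => //.
by rewrite -natr1 in mi *; lra.
Qed.

(** * The two convergence criteria *)

Lemma esum_psi_lty (R : realType) (delta a s : R) : 0 <= s ->
  (\esum_(k in [set: int * int * int]) (psi delta a s k)%:E < +oo)%E <->
  2 < s /\
  ((if 0 <= delta then a - s + 3 * delta else a - s * (1 - 2 * delta)) < 0 /\
   (if 0 <= delta then s * (1 - 2 * delta) - a else s - a - 3 * delta) < 0).
Proof.
move=> s0; rewrite esum_psi.
set u := (X in X < 0 /\ _); set v := (X in _ /\ X < 0).
have envE n : psi_envelope 3 delta a s n = two_sided u v n.
  exact: psi_envelopeE.
split=> [fin|[s2 [u0 v0]]].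
  split.
    rewrite ltNge; apply/negP => s2.
    apply: (@psi_fiber_sum0_pinfty _ delta a s); first by rewrite s0.
    apply: le_lt_trans fin; rewrite (esumID [set 0]); last first.
      by move=> n _; exact: psi_fiber_sum_ge0.
    rewrite setTI esum_set1 ?psi_fiber_sum_ge0// leeDl// esum_ge0// => n _.
    exact: psi_fiber_sum_ge0.
  apply: contrapT => /two_sided_ge1[e einj e1].
  have c0 : 0 < 9 `^ (- s) :> R by rewrite powR_gt0.
  apply: (esum_infinitely_ge einj (@psi_fiber_sum_ge0 _ delta a s) c0 _ fin).
  move=> i; apply: le_trans (psi_fiber_sum_ge _ _ _ s0).
  by rewrite lee_fin envE ler_peMr// ltW.
apply: le_lt_trans
  (esum_two_sided_lty (sqr_ge0 (2 * (s / 2 / (s / 2 - 1)))) u0 v0).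
apply: le_esum => n _; rewrite -envE; exact: psi_fiber_sum_le.
Qed.

Lemma psi_bounded (R : realType) (delta a b : R) : 0 <= b ->
  bounded_fun (psi delta a b : int * int * int -> R^o) <->
  (if 0 <= delta then a - b else a - b * (1 - 2 * delta)) <= 0 /\
  (if 0 <= delta then b * (1 - 2 * delta) - a else b - a) <= 0.
Proof.
move=> b0; set u := (X in X <= 0 /\ _); set v := (X in _ /\ X <= 0).
have envE n : 2 `^ (n%:~R * a) * psi_scale delta n `^ (- b) = two_sided u v n.
  have := psi_envelopeE 0 delta a b n.
  by rewrite /psi_envelope expr0 divr1 mul0r addr0 subr0.
rewrite -two_sided_bounded; split=> [[M [_ bM]]|[B uvB]].
  exists (3 `^ b * (M + 1)) => n; rewrite mulrC -ler_pdivrMr ?powR_gt0//.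
  have M1 : M < M + 1 by rewrite ltrDl.
  apply: le_trans (bM _ M1 (n, 0, 0 ^+ 2 - 0) I).
  rewrite ger0_norm; last exact: psi_ge0.
  have /andP[+ _] := psi_bounds delta a n 0 0 b0; apply: le_trans.
  rewrite /psi_bracket normr0 !mulr0 !addr0 mulr1 powRM//; last first.
    exact/ltW/psi_scale_gt0.
  by rewrite -envE mulrCA [leLHS]mulrC (powRN 3).
exists B; split => [|M BM [[n m1] m2] _]; first exact: num_real.
rewrite /globally/= ger0_norm; last exact: (psi_ge0 _ _ _ (n, m1, m2)).
apply/ltW; apply: le_lt_trans BM.
apply: le_trans (uvB n); rewrite -envE.
have /andP[_] := psi_bounds delta a n m1 (m1 ^+ 2 - m2) b0.
rewrite subKr => /le_trans; apply; rewrite ler_pM2l ?powR_gt0//.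
apply: powRN_anti => //; first exact: psi_scale_gt0.
by rewrite ler_peMr ?psi_bracket_ge1// ltW// psi_scale_gt0.
Qed.

Unset Implicit Arguments.

Local Close Scope classical_set_scope.

Theorem corollary5p3 (R : realType) (delta a b : R) (theta : \bar R)
    (hb : 0 <= b) (htheta : (0 < theta)%E) :
  in_ell theta (psi delta a b) <->
  [/\ 0 <= delta ->
        (forall t : R, theta = t%:E ->
           2 < b * t /\ b * (1 - 2 * delta) < a < - (3 * delta / t) + b) /\
        (theta = +oo%E -> b * (1 - 2 * delta) <= a <= b)
    & delta < 0 ->
        (forall t : R, theta = t%:E ->
           2 < b * t /\ - (3 * delta / t) + b < a < b * (1 - 2 * delta)) /\
        (theta = +oo%E -> b <= a <= b * (1 - 2 * delta))].
Proof.
case: theta htheta => [t|_|//] /=.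
  rewrite lte_fin => t0.
  have -> : summable setT (fun k => (`|psi delta a b k| `^ t)%:E) <->
      (\esum_(k in [set: int * int * int]%classic)
         (psi delta (a * t) (b * t) k)%:E < +oo)%E.
    rewrite /summable; under eq_esum => k _.
      by rewrite gee0_abs ?lee_fin ?powR_ge0// psi_powR; over.
    by [].
  have bt0 : 0 <= b * t by rewrite mulr_ge0// ltW.
  rewrite esum_psi_lty//.
  have lowE : (b * (1 - 2 * delta) < a) = (b * t * (1 - 2 * delta) < a * t).
    by rewrite -(ltr_pM2r t0) mulrAC.
  have lowE' : (a < b * (1 - 2 * delta)) = (a * t < b * t * (1 - 2 * delta)).
    by rewrite -(ltr_pM2r t0) [in LHS]mulrAC.
  have dt : (- (3 * delta / t) + b) * t = b * t - 3 * delta.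
    by field; rewrite gt_eqF.
  have uppE : (a < - (3 * delta / t) + b) = (a * t < b * t - 3 * delta).
    by rewrite -(ltr_pM2r t0) dt.
  have uppE' : (- (3 * delta / t) + b < a) = (b * t - 3 * delta < a * t).
    by rewrite -(ltr_pM2r t0) dt.
  split.
    have [d0|d0] := leP 0 delta => -[s2 [u0 v0]]; split=> d0'.
    - by split=> // t' [<-]; rewrite lowE uppE; split=> //; lra.
    - by [].
    - by [].
    - by split=> // t' [<-]; rewrite lowE' uppE'; split=> //; lra.
  case=> pos neg; have [d0|d0] := leP 0 delta.
    have [/(_ t erefl)[s2 /andP[lo up]] _] := pos d0.
    by rewrite lowE in lo; rewrite uppE in up; split=> //; split; lra.
  have [/(_ t erefl)[s2 /andP[lo up]] _] := neg d0.
  by rewrite uppE' in lo; rewrite lowE' in up; split=> //; split; lra.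
apply: (iff_trans (psi_bounded delta a hb)); split.
  have [d0|d0] := leP 0 delta => -[u0 v0]; split=> d0'.
  - by split=> // _; lra.
  - by [].
  - by [].
  - by split=> // _; lra.
case=> pos neg; have [d0|d0] := leP 0 delta.
  by have [_ /(_ erefl)/andP[? ?]] := pos d0; lra.
by have [_ /(_ erefl)/andP[? ?]] := neg d0; lra.
Qed.
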